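(* Let $$F(\xi,x)=f(\xi)+\sum_{\langle \boldsymbol{k},\boldsymbol{w}\rangle\leq d-1}c_{\boldsymbol{k}}(x)\,\xi^{\boldsymbol{k}}$$ be a semi-quasielliptic polynomial, where $f(\xi)$ is a quasielliptic polynomial of degree $d$ with respect to $\boldsymbol{w}=(w_1,\ldots,w_n)$, and let $\Xi(\xi)=\sum_{i=1}^{n}|\xi_i|_p^{d/w_i}$. Then there exist positive constants $A_0,A_1,M_0$, with $M_0\in\mathbb{N}$, which do not depend on $x$, such that $$A_0\,\Xi(\xi)\leq |F(\xi,x)|_p\leq A_1\,\Xi(\xi)\quad\text{for } \|\xi\|_p\geq p^{M_0}$$ (and for all $x\in\mathbb{Q}_p^n$).
   Context: $p$ is a prime, $|\cdot|_p$ is the $p$-adic absolute value on $\mathbb{Q}_p$, and $\|\xi\|_p=\max_i|\xi_i|_p$ for $\xi=(\xi_1,\ldots,\xi_n)\in\mathbb{Q}_p^n$. A non-constant polynomial $f(\xi)\in\mathbb{Q}_p[\xi_1,\ldots,\xi_n]$ is called quasielliptic of degree $d$ with respect to $\boldsymbol{w}=(w_1,\ldots,w_n)\in(\mathbb{N}\setminus\{0\})^n$ if: (Q1) $f(\lambda^{w_1}\xi_1,\ldots,\lambda^{w_n}\xi_n)=\lambda^d f(\xi)$ for all $\lambda\in\mathbb{Q}_p^\times$; and (Q2) $f(\xi)=0\Leftrightarrow \xi=0$. By convention all quasielliptic polynomials are assumed to have coefficients in $\mathbb{Z}_p$. $\langle\cdot,\cdot\rangle$ is the usual inner product of $\mathbb{R}^n$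 and $\boldsymbol{k}$ ranges over multi-indices in $\mathbb{N}^n$. $F(\xi,x)=f(\xi)+\sum_{\langle \boldsymbol{k},\boldsymbol{w}\rangle\leq d-1}c_{\boldsymbol{k}}(x)\xi^{\boldsymbol{k}}$ is called a semi-quasielliptic polynomial (with variable coefficients) if $f$ is quasielliptic of degree $d$ with respect to $\boldsymbol{w}$ and each $c_{\boldsymbol{k}}:\mathbb{Q}_p^n\to\mathbb{Q}_p$ satisfies $\|c_{\boldsymbol{k}}\|_{L^\infty}:=\sup_{x\in\mathbb{Q}_p^n}|c_{\boldsymbol{k}}(x)|_p<\infty$. *)

(* Defs.v *)
From HB Require Import structures.
From mathcomp Require Import all_boot all_order all_algebra.
From mathcomp Require Import all_classical all_reals all_analysis.
(* The notations of mpoly clash with those of MathComp-Analysis. *)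
From mathcomp Require Import -(notations) mpoly.
Import Order.TTheory GRing.Theory Num.Theory.
Import numFieldNormedType.Exports.

Set Implicit Arguments.
Unset Strict Implicit.
Unset Printing Implicit Defensive.

Local Open Scope classical_set_scope.
Local Open Scope ring_scope.

Definition ratval (p : nat) (q : rat) : int :=
  (logn p `|numq q|)%:Z - (logn p `|denq q|)%:Z.

Definition ratabs (p : nat) (q : rat) : rat :=
  if q == 0 then 0 else p%:Q ^ (- ratval p q).

Section RatAbs.
Variables (p : nat) (p_pr : prime p).
Implicit Types (a b : int) (x y z : rat) (u v : nat -> rat).

Let p_gt0 : 0 < p%:Q.
Proof. by rewrite ltr0n prime_gt0. Qed.

Let p_ge1 : 1 <= p%:Q.
Proof. by rewrite ler1n prime_gt0. Qed.

Lemma ratabs0 : ratabs p 0 = 0.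
Proof. by rewrite /ratabs eqxx. Qed.

Lemma ratabs_gt0 x : x != 0 -> 0 < ratabs p x.
Proof. by move=> x0; rewrite /ratabs (negPf x0) exprz_gt0. Qed.

Lemma ratabs_ge0 x : 0 <= ratabs p x.
Proof. by have [->|/ratabs_gt0/ltW//] := eqVneq x 0; rewrite ratabs0. Qed.

Lemma ratval_frac a b : a != 0 -> b != 0 ->
  ratval p (a%:~R / b%:~R) = (logn p `|a|)%:Z - (logn p `|b|)%:Z.
Proof.
move=> a0 b0; set x : rat := _ / _.
have x0 : x != 0 by rewrite mulf_neq0 ?invr_eq0 ?intr_eq0.
have nx0 : numq x != 0 by rewrite numq_eq0.
have /(congr1 (fun z : int => logn p `|z|%N)) : numq x * b = a * denq x.
  apply: (@intr_inj rat); rewrite !rmorphM /=.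
  have b0' : b%:~R != 0 :> rat by rewrite intr_eq0.
  have d0' : (denq x)%:~R != 0 :> rat by rewrite intr_eq0 denq_neq0.
  by apply/eqP; rewrite -eqr_div // divq_num_den.
rewrite !abszM !lognM ?absz_gt0 ?denq_neq0 // => /(congr1 Posz).
by rewrite !PoszD /ratval => e; apply/eqP; rewrite subr_eq addrAC eq_sym subr_eq -e addrC.
Qed.

Lemma ratabs1 : ratabs p 1 = 1.
Proof.
have e : ratval p (1%:~R / 1%:~R) = 0 by rewrite ratval_frac // subrr.
by rewrite /ratabs oner_eq0; move: e; rewrite divr1 => ->; rewrite oppr0 expr0z.
Qed.

Lemma ratabsN x : ratabs p (- x) = ratabs p x.
Proof. by rewrite /ratabs oppr_eq0 /ratval numqN denqN abszN. Qed.

Lemma ratabsM x y : ratabs p (x * y) = ratabs p x * ratabs p y.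
Proof.
have [->|x0] := eqVneq x 0; first by rewrite mul0r ratabs0 mul0r.
have [->|y0] := eqVneq y 0; first by rewrite mulr0 ratabs0 mulr0.
rewrite /ratabs mulf_eq0 (negPf x0) (negPf y0) /= -expfzDr ?gt_eqF //.
congr (_ ^ _); rewrite -{1}(divq_num_den x) -{1}(divq_num_den y) mulf_div.
rewrite -!rmorphM ratval_frac ?mulf_neq0 ?numq_eq0 ?denq_neq0 //.
rewrite !abszM !lognM ?absz_gt0 ?numq_eq0 ?denq_neq0 // !PoszD /ratval.
by rewrite -[RHS]opprD [in RHS]addrACA -[in RHS]opprD.
Qed.

Lemma ratabsV x : ratabs p x^-1 = (ratabs p x)^-1.
Proof.
have [->|x0] := eqVneq x 0; first by rewrite invr0 ratabs0 ?invr0.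
apply: (mulfI (lt0r_neq0 (ratabs_gt0 x0))).
by rewrite -ratabsM divff // ratabs1 divff // lt0r_neq0 // ratabs_gt0.
Qed.

Lemma ratabsD x y : ratabs p (x + y) <= Num.max (ratabs p x) (ratabs p y).
Proof.
have [->|x0] := eqVneq x 0; first by rewrite add0r le_max lexx orbT.
have [->|y0] := eqVneq y 0; first by rewrite addr0 le_max lexx.
have [->|xy0] := eqVneq (x + y) 0.
  by rewrite ratabs0 le_max ratabs_ge0.
pose a := numq x * denq y; pose c := numq y * denq x; pose b := denq x * denq y.
have b0 : b != 0 by rewrite mulf_neq0 ?denq_neq0.
have a0 : a != 0 by rewrite mulf_neq0 ?denq_neq0 ?numq_eq0.
have c0 : c != 0 by rewrite mulf_neq0 ?denq_neq0 ?numq_eq0.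
have xE : x = a%:~R / b%:~R.
  by rewrite !rmorphM /= -mulf_div divff ?intr_eq0 ?denq_neq0// mulr1 divq_num_den.
have yE : y = c%:~R / b%:~R.
  rewrite !rmorphM /= [X in _ / X]mulrC -mulf_div divff ?intr_eq0 ?denq_neq0//.
  by rewrite mulr1 divq_num_den.
have xyE : x + y = (a + c)%:~R / b%:~R by rewrite rmorphD /= mulrDl -xE -yE.
have ac0 : a + c != 0.
  by apply: contraNneq xy0 => ac0; rewrite xyE ac0 mul0r.
rewrite /ratabs (negPf x0) (negPf y0) (negPf xy0).
rewrite xyE {1}xE {1}yE !ratval_frac // !opprB.
pose k := minn (logn p `|a|) (logn p `|c|).
have : (k <= logn p `|(a + c)%R|)%N.
  rewrite -pfactor_dvdn ?absz_gt0 //.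
  have : ((p ^ k)%N%:Z %| a + c)%Z.
    by rewrite rpredD //= dvdzE pfactor_dvdn ?absz_gt0 // (geq_minl, geq_minr).
  by rewrite dvdzE.
by rewrite geq_min => /orP[] h; rewrite le_max; apply/orP; [left|right];
  apply: ler_weXz2l => //; rewrite lerD2l lerN2 lez_nat.
Qed.

Lemma ratabsB x y : ratabs p (x - y) <= Num.max (ratabs p x) (ratabs p y).
Proof. by rewrite -(ratabsN y); exact: ratabsD. Qed.

Lemma ratabs_dist x y : ratabs p (x - y) < ratabs p x ->
  ratabs p y = ratabs p x.
Proof.
move=> h; apply/eqP; rewrite eq_le; apply/andP; split.
  by have := ratabsB x (x - y); rewrite subKr (max_idPl (ltW h)).
by have := ratabsD (x - y) y; rewrite subrK le_max leNgt h.
Qed.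

End RatAbs.

Definition padic_cauchy_seq (p : nat) (p_pr : prime p) (u : nat -> rat) : Prop :=
  forall e : rat, 0 < e -> exists N : nat,
    forall m n : nat, (N <= m)%N -> (N <= n)%N -> ratabs p (u m - u n) < e.

Definition padic_null_seq (p : nat) (p_pr : prime p) (u : nat -> rat) : Prop :=
  forall e : rat, 0 < e -> exists N : nat,
    forall n : nat, (N <= n)%N -> ratabs p (u n) < e.

Definition padic_cauchy_pred p p_pr : {pred nat -> rat} :=
  fun u => `[< @padic_cauchy_seq p p_pr u >].

Section CauchyRing.
Variables (p : nat) (p_pr : prime p).
Implicit Types u v : nat -> rat.

Lemma padic_cauchy_bounded u : padic_cauchy_seq p_pr u ->
  exists2 M : rat, 0 < M & exists N : nat,
    forall n, (N <= n)%N -> ratabs p (u n) < M.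
Proof.
move=> /(_ 1 ltr01)[N hN]; exists (1 + ratabs p (u N)).
  by rewrite ltr_wpDr ?ratabs_ge0.
exists N => n Nn; have := ratabsD p_pr (u n - u N) (u N).
rewrite subrK => /le_lt_trans; apply; rewrite gt_max.
by rewrite ltr_wpDr ?ratabs_ge0 ?hN //= ltr_pwDl.
Qed.

Fact padic_cauchy_subring : subring_closed (padic_cauchy_pred p_pr).
Proof.
split.
- apply/asboolP => e e0; exists 0%N => m n _ _.
  by rewrite subrr ratabs0.
- move=> u v /asboolP hu /asboolP hv; apply/asboolP => e e0.
  have [N hN] := hu _ e0; have [M hM] := hv _ e0.
  exists (maxn N M) => m n; rewrite !geq_max => /andP[Nm Mm] /andP[Nn Mn].
  have -> : (u - v) m - (u - v) n = (u m - u n) - (v m - v n).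
    by rewrite /= !opprD !opprK addrACA.
  by apply: le_lt_trans (ratabsB p_pr _ _) _; rewrite gt_max hN ?hM.
- move=> u v /asboolP hu /asboolP hv; apply/asboolP => e e0.
  have [A A0 [NA hA]] := padic_cauchy_bounded hu.
  have [B B0 [NB hB]] := padic_cauchy_bounded hv.
  have [N hN] := hu _ (divr_gt0 e0 B0); have [M hM] := hv _ (divr_gt0 e0 A0).
  exists (maxn (maxn NA NB) (maxn N M)) => m n; rewrite !geq_max.
  move=> /andP[/andP[NAm NBm] /andP[Nm Mm]] /andP[/andP[NAn NBn] /andP[Nn Mn]].
  have -> : (u * v) m - (u * v) n = u m * (v m - v n) + (u m - u n) * v n.
    by rewrite mulrBr mulrBl subrKA.
  apply: le_lt_trans (ratabsD p_pr _ _) _; rewrite gt_max !ratabsM //.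
  apply/andP; split.
    rewrite -(divfK (lt0r_neq0 A0) e) mulrC.
    by apply: ltr_pM; rewrite ?ratabs_ge0 ?hM ?hA.
  rewrite -(divfK (lt0r_neq0 B0) e).
  by apply: ltr_pM; rewrite ?ratabs_ge0 ?hN ?hB.
Qed.

HB.instance Definition _ := GRing.isSubringClosed.Build (nat -> rat)
  (padic_cauchy_pred p_pr) padic_cauchy_subring.

End CauchyRing.

Record padic_cauchy (p : nat) (p_pr : prime p) := PadicCauchy {
  padic_cauchy_val :> nat -> rat;
  _ : padic_cauchy_val \in padic_cauchy_pred p_pr }.

HB.instance Definition _ p p_pr :=
  [isSub for @padic_cauchy_val p p_pr].
HB.instance Definition _ p p_pr :=
  [Choice of @padic_cauchy p p_pr by <:].
HB.instance Definition _ p p_pr :=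
  [SubChoice_isSubComNzRing of @padic_cauchy p p_pr by <:].

Definition padic_null p p_pr : {pred @padic_cauchy p p_pr} :=
  fun u => `[< padic_null_seq p_pr u >].

Section NullIdeal.
Variables (p : nat) (p_pr : prime p).
Implicit Types u v : padic_cauchy p_pr.

Lemma padic_cauchyP u : padic_cauchy_seq p_pr u.
Proof. by apply/asboolP; exact: (valP u). Qed.

Lemma padic_cauchy0E n : (0 : padic_cauchy p_pr) n = 0.
Proof. by []. Qed.

Lemma padic_cauchy1E n : (1 : padic_cauchy p_pr) n = 1.
Proof. by []. Qed.

Lemma padic_cauchyDE u v n : (u + v) n = u n + v n.
Proof. by []. Qed.

Lemma padic_cauchyNE u n : (- u) n = - u n.
Proof. by []. Qed.

Lemma padic_cauchyME u v n : (u * v) n = u n * v n.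
Proof. by []. Qed.

Fact padic_null_idealr : idealr_closed (@padic_null p p_pr).
Proof.
split.
- by apply/asboolP => e e0; exists 0%N => n _; rewrite padic_cauchy0E ratabs0.
- apply/negP => /asboolP /(_ 1 ltr01)[N /(_ N (leqnn N))].
  by rewrite padic_cauchy1E ratabs1 // ltxx.
- move=> a u v /asboolP hu /asboolP hv; apply/asboolP => e e0.
  have [A A0 [NA hA]] := padic_cauchy_bounded (padic_cauchyP a).
  have [N hN] := hu _ (divr_gt0 e0 A0); have [M hM] := hv _ e0.
  exists (maxn NA (maxn N M)) => n; rewrite !geq_max => /and3P[NAn Nn Mn].
  have -> : (a * u + v : padic_cauchy p_pr) n = a n * u n + v n.
    by rewrite padic_cauchyDE padic_cauchyME.
  apply: le_lt_trans (ratabsD p_pr _ _) _; rewrite gt_max ratabsM // hM // andbT.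
  rewrite -(divfK (lt0r_neq0 A0) e) mulrC.
  by apply: ltr_pM; rewrite ?ratabs_ge0 ?hN ?hA.
Qed.

HB.instance Definition _ := isIdealr.Build (padic_cauchy p_pr)
  (@padic_null p p_pr) padic_null_idealr.

End NullIdeal.

(* Q_p, as the completion of Q: Cauchy sequences of rationals for |.|_p,
   modulo null sequences. *)
Definition Qp (p : nat) (p_pr : prime p) := {ideal_quot @padic_null p p_pr}.

HB.instance Definition _ p p_pr := GRing.ComNzRing.on (@Qp p p_pr).
HB.instance Definition _ p p_pr := Quotient.on (@Qp p p_pr).

Section QpField.
Variables (p : nat) (p_pr : prime p).
Implicit Types (u v : padic_cauchy p_pr) (x y : Qp p_pr).
Local Open Scope quotient_scope.

Lemma padic_non_null u : u \notin @padic_null p p_pr ->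
  exists2 c : rat, 0 < c & exists N : nat,
    forall n, (N <= n)%N -> c <= ratabs p (u n).
Proof.
move=> /asboolPn/existsNP[e /not_implyP[e0 /forallNP hN]].
have [M hM] := padic_cauchyP u e0.
have /existsNP[n0 /not_implyP[Mn0 /negP]] := hN M; rewrite -leNgt => en0.
exists e => //; exists M => n Mn.
suff -> : ratabs p (u n) = ratabs p (u n0) by [].
by apply: ratabs_dist => //; apply: lt_le_trans en0; exact: hM.
Qed.

Lemma padic_cauchy_inv u : u \notin @padic_null p p_pr ->
  (fun n => (u n)^-1) \in padic_cauchy_pred p_pr.
Proof.
move=> /padic_non_null[c c0 [N hN]]; apply/asboolP => e e0.
have [M hM] := padic_cauchyP u (mulr_gt0 e0 (mulr_gt0 c0 c0)).
exists (maxn N M) => m n; rewrite !geq_max => /andP[Nm Mm] /andP[Nn Mn].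
have cm := hN _ Nm; have cn := hN _ Nn.
have um0 : u m != 0.
  by apply: contraTneq (lt_le_trans c0 cm) => ->; rewrite ratabs0 ltxx.
have un0 : u n != 0.
  by apply: contraTneq (lt_le_trans c0 cn) => ->; rewrite ratabs0 ltxx.
have -> : (u m)^-1 - (u n)^-1 = (u n - u m) / (u m * u n).
  rewrite invfM mulrBl mulrCA divff // mulr1 [_^-1 / _]mulrC.
  by rewrite mulrCA divff // mulr1.
rewrite ratabsM // ratabsV // ltr_pdivrMr ?ratabs_gt0 ?mulf_neq0 //.
apply: lt_le_trans (hM _ _ Mn Mm) _; rewrite ler_wpM2l ?(ltW e0) // ratabsM //.
by apply: ler_pM => //; exact: ltW.
Qed.

Definition Qp_inv x : Qp p_pr :=
  if x == 0 then 0
  else \pi_(Qp p_pr) (insubd (0 : padic_cauchy p_pr) (fun n => (repr x n)^-1)).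

Lemma Qp_pi_eq0 u : (\pi_(Qp p_pr) u == 0) = (u \in @padic_null p p_pr).
Proof. by rewrite -[u in RHS]subr0 Quotient.idealrBE pi_zeror. Qed.

Fact Qp_mulVf x : x != 0 -> Qp_inv x * x = 1.
Proof.
move=> x0; rewrite /Qp_inv (negPf x0).
have u0 : repr x \notin @padic_null p p_pr by rewrite -Qp_pi_eq0 reprK.
set v := insubd _ _.
have vE n : v n = (repr x n)^-1.
  by rewrite /v -[LHS]/(val (insubd _ _) n) insubdK // padic_cauchy_inv.
rewrite -[x in _ * x]reprK.
apply/eqP; rewrite -subr_eq0.
have -> : \pi_(Qp p_pr) v * \pi_(Qp p_pr) (repr x) - 1 =
  \pi_(Qp p_pr) (v * repr x - 1) by rewrite pi_addr pi_mulr pi_oppr pi_oner.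
rewrite Qp_pi_eq0.
have [c c0 [N hN]] := padic_non_null u0.
apply/asboolP => e e0; exists N => n Nn.
rewrite padic_cauchyDE padic_cauchyNE padic_cauchyME padic_cauchy1E vE.
rewrite mulVf ?subrr ?ratabs0 //.
by apply: contraTneq (lt_le_trans c0 (hN _ Nn)) => ->; rewrite ratabs0 ltxx.
Qed.

Fact Qp_inv0 : Qp_inv 0 = 0.
Proof. by rewrite /Qp_inv eqxx. Qed.

HB.instance Definition _ := GRing.ComNzRing_isField.Build (Qp p_pr)
  Qp_mulVf Qp_inv0.

End QpField.

(* Along a Cauchy sequence, ratabs converges (and is eventually constant
   unless the sequence is null). *)
Definition padic_norm (R : realType) (p : nat) (p_pr : prime p)
    (x : Qp p_pr) : R :=
  limn (fun n => ratr (ratabs p ((repr x : padic_cauchy p_pr) n)) : R).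

Arguments padic_norm R {p p_pr} x.

Definition padic_maxnorm (R : realType) (p : nat) (p_pr : prime p) (n : nat)
    (xi : 'rV[Qp p_pr]_n) : R :=
  \big[Num.max/0]_(i < n) padic_norm R (xi ord0 i).

Arguments padic_maxnorm R {p p_pr n} xi.

Definition peval (K : comNzRingType) (n : nat) (f : mpoly n K)
    (xi : 'rV[K]_n) : K :=
  meval (fun i => xi ord0 i) f.

Definition wdilate (K : comNzRingType) (n : nat) (w : 'I_n -> nat)
    (lambda : K) (xi : 'rV[K]_n) : 'rV[K]_n :=
  \row_i (lambda ^+ w i * xi ord0 i).

Definition wdeg (n : nat) (w : 'I_n -> nat) (k : multinom n) : nat :=
  (\sum_(i < n) k i * w i)%N.

Record quasielliptic (R : realType) (p : nat) (p_pr : prime p) (n : nat)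
    (f : mpoly n (Qp p_pr)) (d : nat) (w : 'I_n -> nat) : Prop :=
  Quasielliptic {
    qe_weights : forall i, (0 < w i)%N;
    qe_nonconstant : forall a : Qp p_pr, f <> mpolyC n a;
    qe_integral : forall m : multinom n, padic_norm R (mcoeff m f) <= 1;
    qe_homogeneous : forall (lambda : Qp p_pr) (xi : 'rV[Qp p_pr]_n),
      lambda != 0 ->
      peval f (wdilate w lambda xi) = lambda ^+ d * peval f xi;
    qe_anisotropic : forall xi : 'rV[Qp p_pr]_n, peval f xi = 0 <-> xi = 0 }.

Arguments quasielliptic R {p p_pr n} f d w.

(* [wdeg w k < d] is the condition <k, w> <= d - 1 over the integers.  As the
   weights are positive it implies |k| < d, so that it is enough to let k range
   over the finite type [bmultinom n d] of multi-indices with |k| < d. *)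
Definition semi_quasielliptic_poly (K : comNzRingType) (n : nat)
    (f : mpoly n K) (d : nat) (w : 'I_n -> nat)
    (c : multinom n -> 'rV[K]_n -> K) (x : 'rV[K]_n) : mpoly n K :=
  f + \sum_(k : bmultinom n d | (wdeg w k < d)%N) c k x *: mpolyX K k.

Record semi_quasielliptic (R : realType) (p : nat) (p_pr : prime p) (n : nat)
    (f : mpoly n (Qp p_pr)) (d : nat) (w : 'I_n -> nat)
    (c : multinom n -> 'rV[Qp p_pr]_n -> Qp p_pr) : Prop :=
  SemiQuasielliptic {
    sqe_quasielliptic : quasielliptic R f d w;
    sqe_bounded : forall k : multinom n, (wdeg w k < d)%N ->
      (ereal_sup (range (fun x => (padic_norm R (c k x))%:E)) < +oo)%E }.

Arguments semi_quasielliptic R {p p_pr n} f d w c.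

Definition Xi (R : realType) (p : nat) (p_pr : prime p) (n : nat) (d : nat)
    (w : 'I_n -> nat) (xi : 'rV[Qp p_pr]_n) : R :=
  \sum_(i < n) padic_norm R (xi ord0 i) `^ (d%:R / (w i)%:R).

Arguments Xi R {p p_pr n} d w xi.

(* Main.v *)
(* The set [K] of integral points [eta] having some coordinate of norm larger
   than [p ^- w_i] is compact and avoids the origin, so [|f|] has a positive
   minimum [delta] on it.  Any [xi] of large norm is [eta] in [K] dilated by
   [p ^- m] with [m] large: there [|f(xi)|] lies between [delta * p ^ (m * d)]
   and [p ^ (m * d)], [Xi(xi)] is comparable to [p ^ (m * d)], and the terms of
   weighted degree [< d] are [O(p ^ (m * (d - 1)))].  For large [m] they are
   smaller than [|f(xi)|], so [|F(xi, x)| = |f(xi)|] by the ultrametric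
   inequality.  Compactness is obtained by choosing p-adic digits one after
   another, each time keeping a residue class that still meets every set of the
   decreasing family. *)
Require Import Defs.
From mathcomp Require Import all_boot all_order all_algebra.
From mathcomp Require Import all_classical all_reals all_analysis.
From mathcomp Require Import -(notations) mpoly.
Import Order.TTheory GRing.Theory Num.Theory.
Import numFieldNormedType.Exports.

Set Implicit Arguments.
Unset Strict Implicit.
Unset Printing Implicit Defensive.

Local Open Scope ring_scope.

(** * The norm on [Qp] as a non-archimedean absolute value with values in the powers of p *)

Section PadicNorm.
Variables (R : realType) (p : nat) (p_pr : prime p).
Implicit Types (u v : padic_cauchy p_pr) (x y : Qp p_pr) (q r : rat).
Local Open Scope quotient_scope.

Local Notation normp := (@padic_norm R p p_pr).

Definition pi_Qp u : Qp p_pr := \pi_(Qp p_pr) u.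

Lemma pi_QpD u v : pi_Qp (u + v) = pi_Qp u + pi_Qp v.
Proof. by rewrite /pi_Qp pi_addr. Qed.

Lemma pi_QpM u v : pi_Qp (u * v) = pi_Qp u * pi_Qp v.
Proof. by rewrite /pi_Qp pi_mulr. Qed.

Lemma pi_QpN u : pi_Qp (- u) = - pi_Qp u.
Proof. by rewrite /pi_Qp pi_oppr. Qed.

Lemma pi_Qp1 : pi_Qp 1 = 1.
Proof. by rewrite /pi_Qp pi_oner. Qed.

Lemma pi_Qp_nat n : pi_Qp n%:R = n%:R.
Proof.
elim: n => [|n IH]; first by rewrite /pi_Qp !mulr0n pi_zeror.
by rewrite -addn1 !natrD pi_QpD IH -[1%:R]/(1 : padic_cauchy p_pr) pi_Qp1.
Qed.

Lemma padic_cauchy_natE m n : (m%:R : padic_cauchy p_pr) n = m%:R.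
Proof.
by elim: m => [//|m IH]; rewrite -addn1 !natrD padic_cauchyDE IH.
Qed.

(** The norm is computed on the chosen representative, which differs from [u] by a null sequence. As
    [r] is nonzero, that difference is eventually smaller than [r], and the ultrametric inequality
    then gives both sequences the same absolute value. *)
Lemma padic_norm_eventually u r : r != 0 ->
  (exists N, forall n, (N <= n)%N -> ratabs p (u n) = r) ->
  normp (pi_Qp u) = ratr r.
Proof.
move=> r0 [N hN]; rewrite /padic_norm; apply: lim_near_cst => //.
have : \pi_(Qp p_pr) (repr (pi_Qp u) - u) == 0.
  by rewrite -/(pi_Qp _) pi_QpD pi_QpN /pi_Qp reprK subrr.
have rgt0 : 0 < r.
  by rewrite lt_neqAle eq_sym r0 -(hN N (leqnn N)) ratabs_ge0.
rewrite Qp_pi_eq0 => /asboolP /(_ _ rgt0)[M hM].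
exists (maxn N M) => // n /=; rewrite geq_max => /andP[Nn Mn].
congr ratr; rewrite -(hN _ Nn); apply: (ratabs_dist p_pr).
by rewrite -ratabsN // opprB hN //; exact: hM.
Qed.

Lemma padic_norm0 : normp 0 = 0.
Proof.
have : \pi_(Qp p_pr) (repr (0 : Qp p_pr)) == 0 :> Qp p_pr by rewrite reprK.
rewrite Qp_pi_eq0 => /asboolP hu.
rewrite /padic_norm; apply: cvg_lim => //; apply/cvgrPdist_lt => e e0.
(* Null sequences are tested against rational tolerances only, so a positive rational below [e] is
   needed. *)
have [q q0 qe] : exists2 q : rat, 0 < q & ratr q < e.
  exists (Num.trunc e^-1).+1%:R^-1; first by rewrite invr_gt0.
  rewrite fmorphV /= ratr_nat invf_plt ?posrE //.
  by have /andP[] := truncn_itv (ltW (etrans (invr_gt0 e) e0)).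
have [N hN] := hu _ q0; exists N => // n /= /hN hn.
rewrite sub0r normrN ger0_norm ?ler0q ?ratabs_ge0 //.
by apply: lt_trans qe; rewrite ltr_rat.
Qed.

(** Past [K] the terms of a representative are at least [c] in absolute value and lie at distance
    less than [c] from one another, so their absolute values agree. This reduces facts about the
    norm to facts about [ratabs]. *)
Lemma QpP x : x != 0 -> exists u (z : int), x = pi_Qp u /\
  exists N, forall n, (N <= n)%N -> ratabs p (u n) = p%:R ^ z.
Proof.
move=> x0; have : repr x \notin @padic_null p p_pr by rewrite -Qp_pi_eq0 reprK.
move=> /padic_non_null[c c0 [N hN]]; have [M hM] := padic_cauchyP (repr x) c0.
pose K := maxn N M.
exists (repr x), (- ratval p (repr x K)); split; first by rewrite /pi_Qp reprK.
exists K => n; rewrite geq_max => /andP[Nn Mn].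
have -> : p%:R ^ (- ratval p (repr x K)) = ratabs p (repr x K) :> rat.
  rewrite /ratabs ifN //; apply: contraTneq (lt_le_trans c0 (hN K _)) => [->|].
    by rewrite ratabs0 ltxx.
  by rewrite leq_maxl.
apply: (ratabs_dist p_pr); apply: lt_le_trans (hM _ _ _ _) (hN _ _) => //;
  by rewrite /K leq_max leqnn ?orbT.
Qed.

Let exprz_p_neq0 (z : int) : p%:R ^ z != 0 :> rat.
Proof. by rewrite expfz_neq0 // pnatr_eq0 -lt0n prime_gt0. Qed.

Lemma padic_norm_exprz x : x != 0 -> exists z : int, normp x = p%:R ^ z.
Proof.
move=> /QpP[u [z [-> hu]]]; exists z.
by rewrite (padic_norm_eventually _ hu) // fmorphXz /= ratr_nat.
Qed.

Lemma padic_norm_gt0 x : (0 < normp x) = (x != 0).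
Proof.
have [->|/padic_norm_exprz[z ->]] := eqVneq x 0.
  by rewrite padic_norm0 ltxx.
by rewrite exprz_gt0 // ltr0n prime_gt0.
Qed.

Lemma padic_norm_ge0 x : 0 <= normp x.
Proof.
have [->|x0] := eqVneq x 0; first by rewrite padic_norm0.
by rewrite ltW // padic_norm_gt0.
Qed.

Lemma padic_normM x y : normp (x * y) = normp x * normp y.
Proof.
have [->|/QpP[u [a [-> [N hN]]]]] := eqVneq x 0.
  by rewrite mul0r padic_norm0 mul0r.
have [->|/QpP[v [b [-> [M hM]]]]] := eqVneq y 0.
  by rewrite mulr0 padic_norm0 mulr0.
rewrite -pi_QpM (@padic_norm_eventually u (p%:R ^ a)) //; last by exists N.
rewrite (@padic_norm_eventually v (p%:R ^ b)) //; last by exists M.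
rewrite -rmorphM; apply: padic_norm_eventually; first by rewrite mulf_neq0.
exists (maxn N M) => n; rewrite geq_max => /andP[/hN hn /hM hm].
by rewrite padic_cauchyME ratabsM // hn hm.
Qed.

(** Serves for sums and differences, where cancellation leaves only an upper bound. If the class of
    [u] is nonzero, the absolute values stabilise at that of [u L], which is at most [r]. *)
Lemma padic_norm_eventually_le u r :
  (exists N, forall n, (N <= n)%N -> ratabs p (u n) <= r) ->
  normp (pi_Qp u) <= ratr r.
Proof.
move=> [N hN].
have r0 : 0 <= r := le_trans (ratabs_ge0 p_pr _) (hN N (leqnn N)).
have [->|] := eqVneq (pi_Qp u) 0; first by rewrite padic_norm0 ler0q.
rewrite /pi_Qp Qp_pi_eq0 -/(pi_Qp u).
move=> /padic_non_null[c c0 [K hK]]; have [M hM] := padic_cauchyP u c0.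
pose L := maxn N (maxn K M).
have L0 : ratabs p (u L) != 0.
  by rewrite gt_eqF // (lt_le_trans c0) // hK // /L !leq_max leqnn orbT.
rewrite (padic_norm_eventually L0).
  by rewrite ler_rat hN // leq_maxl.
exists L => n; rewrite !geq_max => /and3P[Nn Kn Mn].
apply: (ratabs_dist p_pr); apply: lt_le_trans (hM _ _ _ _) (hK _ _) => //;
  by rewrite /L !leq_max leqnn ?orbT.
Qed.

Lemma padic_normD x y : normp (x + y) <= Num.max (normp x) (normp y).
Proof.
have [->|/QpP[u [a [-> [N hN]]]]] := eqVneq x 0.
  by rewrite add0r le_max lexx orbT.
have [->|/QpP[v [b [-> [M hM]]]]] := eqVneq y 0.
  by rewrite addr0 le_max lexx.
rewrite -pi_QpD (@padic_norm_eventually u (p%:R ^ a)) //; last by exists N.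
rewrite (@padic_norm_eventually v (p%:R ^ b)) //; last by exists M.
have [ab|ba] := leP (p%:R ^ a : rat) (p%:R ^ b).
  rewrite (max_idPr _) ?ler_rat //; apply: padic_norm_eventually_le.
  exists (maxn N M) => n; rewrite geq_max => /andP[/hN hn /hM hm].
  by rewrite (le_trans (ratabsD p_pr _ _)) // hn hm ge_max ab lexx.
rewrite (max_idPl _) ?ler_rat ?(ltW ba) //; apply: padic_norm_eventually_le.
exists (maxn N M) => n; rewrite geq_max => /andP[/hN hn /hM hm].
by rewrite (le_trans (ratabsD p_pr _ _)) // hn hm ge_max (ltW ba) lexx.
Qed.

Lemma padic_normN x : normp (- x) = normp x.
Proof.
have [->|/QpP[u [a [-> [N hN]]]]] := eqVneq x 0; first by rewrite oppr0.
rewrite -pi_QpN (@padic_norm_eventually u (p%:R ^ a)) //; last by exists N.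
by apply: padic_norm_eventually => //; exists N => n /hN; rewrite -ratabsN.
Qed.

Lemma padic_norm1 : normp 1 = 1.
Proof.
rewrite -pi_Qp1 (@padic_norm_eventually 1 1) ?rmorph1 //.
by exists 0%N => n _; rewrite padic_cauchy1E ratabs1.
Qed.

Lemma ratabs_p : ratabs p p%:R = p%:R^-1.
Proof.
rewrite /ratabs pnatr_eq0 gtn_eqF ?prime_gt0 //.
suff -> : ratval p p%:R = 1 by [].
rewrite -[p%:R]divr1 -[p%:R]/(p%:~R) -[X in _ / X]/(1%:~R).
rewrite ratval_frac // ?gt_eqF ?ltz_nat ?prime_gt0 //.
by rewrite absz_nat logn_prime // eqxx logn1.
Qed.

Lemma padic_norm_p : normp p%:R = p%:R^-1.
Proof.
rewrite -pi_Qp_nat (@padic_norm_eventually _ p%:R^-1).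
- by rewrite fmorphV /= ratr_nat.
- by rewrite (exprz_p_neq0 (-1)).
- by exists 0%N => n _; rewrite padic_cauchy_natE ratabs_p.
Qed.

Lemma padic_normX x m : normp (x ^+ m) = normp x ^+ m.
Proof.
by elim: m => [|m IH]; rewrite ?expr0 ?padic_norm1 // !exprS padic_normM IH.
Qed.

(** * Residues modulo p, digit expansions, and compactness of the integral points *)

Lemma ratabs_int (k : int) : ratabs p k%:~R <= 1.
Proof.
have [->|k0] := eqVneq k 0; first by rewrite ratabs0.
rewrite /ratabs intr_eq0 (negPf k0) -[k%:~R]divr1 -[X in _ / X]/(1%:~R).
rewrite ratval_frac // logn1 subr0 -exprnN invf_le1 ?exprn_gt0 ?ltr0n ?prime_gt0 //.
by rewrite exprn_ege1 // ler1n prime_gt0.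
Qed.

Lemma ratabs_p_mul q : ratabs p q <= 1 -> ratabs p (p%:R * q) <= p%:R^-1.
Proof.
by move=> q1; rewrite ratabsM // ratabs_p ler_piMr // invr_ge0 ler0n.
Qed.

(** If p divided the denominator, it would not divide the numerator of the reduced fraction, and the
    absolute value would be a positive power of p. *)
Lemma ratabs_le1_coprime q : ratabs p q <= 1 -> coprimez (denq q) p.
Proof.
move=> q1; have [->|q0] := eqVneq q 0; first by rewrite /coprimez gcd1z.
rewrite coprimezE absz_nat coprime_sym prime_coprime //.
apply: contraTN q1 => pD; rewrite -ltNge /ratabs (negPf q0).
have pN : ~~ (p %| `|numq q|)%N.
  apply: contraTN (prime_gt1 p_pr) => pN; rewrite -leqNgt.
  have := coprime_num_den q; rewrite /coprime => /eqP <-.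
  by rewrite dvdn_leq ?gcdn_gt0 ?absz_gt0 ?denq_neq0 ?orbT // dvdn_gcd pN pD.
rewrite /ratval (logn_coprime (_ : coprime p `|numq q|)) ?prime_coprime //.
rewrite sub0r opprK -exprnP exprn_egt1 ?ltr1n ?prime_gt1 //.
by rewrite -lt0n logn_gt0 mem_primes p_pr absz_gt0 denq_neq0.
Qed.

(** A Bezout relation [s * denq q + t * p = 1], multiplied by [q], gives
    [q = s * numq q + p * (t * q)]. The residue is therefore that of the integer [s * numq q]. *)
Lemma ratabs_residue q : ratabs p q <= 1 ->
  exists a : 'I_p, ratabs p (q - a%:R) <= p%:R^-1.
Proof.
move=> q1; have /coprimezP[[s t] /= st] := ratabs_le1_coprime q1.
have p0 : p%:Z != 0 by rewrite gt_eqF // ltz_nat prime_gt0.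
pose a := ((s * numq q) %% p)%Z.
have aE : `|a|%N%:Z = a by rewrite gez0_abs // modz_ge0.
have ap : (`|a| < p)%N by rewrite -ltz_nat aE ltz_pmod // ltz_nat prime_gt0.
exists (Ordinal ap) => /=.
have -> : q - `|a|%N%:R = p%:R * (t%:~R * q + ((s * numq q) %/ p)%Z%:~R).
  have qE : q = s%:~R * (numq q)%:~R + p%:R * (t%:~R * q).
    have /(congr1 (fun z : int => z%:~R * q)) := st.
    rewrite mul1r rmorphD !rmorphM /= mulrDl => q_eq.
    apply: etrans (esym q_eq) _; congr (_ + _).
      by rewrite numqE -mulrA [_ * q]mulrC.
    by rewrite -mulrA mulrCA.
  rewrite {1}qE -[`|a|%N%:R]/(`|a|%N%:Z%:~R) aE -rmorphM /=.
  rewrite {1}(divz_eq (s * numq q) p) -/a rmorphD rmorphM /= mulrDr.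
  by rewrite addrAC addrK addrC [_ * p%:~R]mulrC.
apply: ratabs_p_mul; apply: le_trans (ratabsD p_pr _ _) _.
by rewrite ge_max ratabs_int andbT ratabsM // mulr_ile1 ?ratabs_ge0 ?ratabs_int.
Qed.

Lemma padic_residue x : normp x <= 1 ->
  exists a : 'I_p, normp (x - a%:R) <= p%:R^-1.
Proof.
have p0 : 0 < p%:R^-1 :> rat by rewrite invr_gt0 ltr0n prime_gt0.
have -> : p%:R^-1 = ratr p%:R^-1 :> R by rewrite fmorphV /= ratr_nat.
have [->|/QpP[u [z [-> [N hN]]]]] := eqVneq x 0 => [_|].
  exists (Ordinal (prime_gt0 p_pr)); rewrite subr0 padic_norm0.
  by rewrite ler0q ltW.
rewrite (@padic_norm_eventually u (p%:R ^ z)) //; last by exists N.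
move=> z1; have {}z1 : p%:R ^ z <= 1 :> rat by rewrite -(ler_rat R) rmorph1.
(* With Cauchy tolerance 1/p, the rational [u K] has the same residue as [x]. *)
have [M hM] := padic_cauchyP u p0; pose K := maxn N M.
have /ratabs_residue[a ha] : ratabs p (u K) <= 1 by rewrite hN // leq_maxl.
exists a; rewrite -pi_Qp_nat -pi_QpN -pi_QpD; apply: padic_norm_eventually_le.
exists K => n; rewrite geq_max => /andP[Nn Mn].
rewrite padic_cauchyDE padic_cauchyNE padic_cauchy_natE -(subrKA (u K)).
apply: le_trans (ratabsD p_pr _ _) _.
by rewrite ge_max ha andbT ltW // hM // leq_maxr.
Qed.

(** Division by [p ^ j] turns the search for the next digit into that for a residue. *)
Lemma padic_digit x j : normp x <= p%:R ^- j ->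
  exists a : 'I_p, normp (x - (p ^ j * a)%:R) <= p%:R ^- j.+1.
Proof.
move=> xj; have pj : 0 < p%:R ^- j :> R.
  by rewrite invr_gt0 exprn_gt0 // ltr0n prime_gt0.
have npj : normp (p%:R ^+ j) = p%:R ^- j by rewrite padic_normX padic_norm_p exprVn.
have pj0 : p%:R ^+ j != 0 :> Qp p_pr by rewrite -padic_norm_gt0 npj.
have [a ha] : exists a : 'I_p, normp (x / p%:R ^+ j - a%:R) <= p%:R^-1.
  apply: padic_residue; rewrite -(ler_pM2r pj) -npj -padic_normM divfK //.
  by rewrite mul1r npj.
exists a; have -> : x - (p ^ j * a)%:R = p%:R ^+ j * (x / p%:R ^+ j - a%:R).
  by rewrite mulrBr mulrCA divff // mulr1 natrM natrX.
by rewrite padic_normM npj exprS invfM [leRHS]mulrC ler_pM2l.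
Qed.

(** The sum of the series is the class of its own sequence of partial sums, which is Cauchy because
    [p ^ j] divides every block of terms starting at index [j]. *)
Lemma padic_series (r : nat -> nat) : exists x : Qp p_pr, forall j,
  normp (x - (\sum_(0 <= i < j) p ^ i * r i)%:R) <= p%:R ^- j.
Proof.
pose s j : rat := (\sum_(0 <= i < j) p ^ i * r i)%:R.
have p0 : 0 < p%:R :> rat by rewrite ltr0n prime_gt0.
have sE j m : (j <= m)%N -> ratabs p (s m - s j) <= p%:R ^- j.
  move=> jm; rewrite /s (big_cat_nat _ jm) //= natrD addrAC subrr add0r.
  have /dvdnP[k ->] : (p ^ j %| \sum_(j <= i < m) p ^ i * r i)%N.
    rewrite big_seq_cond; apply: dvdn_sum => i; rewrite mem_index_iota andbT.
    by move=> /andP[ji _]; rewrite dvdn_mulr // dvdn_exp2l.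
  rewrite natrM ratabsM // natrX.
  have -> : ratabs p (p%:R ^+ j) = p%:R ^- j.
    elim: (j) => [|i IH]; first by rewrite expr0 ratabs1 invr1.
    by rewrite exprS ratabsM // IH ratabs_p invfM.
  by rewrite ler_piMl ?(ratabs_int k) // invr_ge0 exprn_ge0 // ltW.
have sC : s \in padic_cauchy_pred p_pr.
  apply/asboolP => e e0.
  have [N hN] : exists N, p%:R ^- N < e.
    exists (Num.bound e^-1); rewrite invf_plt ?posrE ?exprn_gt0 //.
    apply: lt_le_trans (upper_nthrootP (leqnn _)) _.
    by rewrite lerXn2r ?nnegrE ?ler0n // ler_nat prime_gt1.
  have sN m : (N <= m)%N -> ratabs p (s m - s N) < e.
    by move=> Nm; apply: le_lt_trans hN; exact: sE.
  exists N => m n Nm Nn; rewrite -(subrKA (s N)).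
  apply: le_lt_trans (ratabsD p_pr _ _) _.
  by rewrite gt_max sN //= -ratabsN opprB sN.
exists (pi_Qp (PadicCauchy sC)) => j.
have -> : p%:R ^- j = ratr (p%:R ^- j) :> R by rewrite fmorphV rmorphXn /= ratr_nat.
rewrite -pi_Qp_nat -pi_QpN -pi_QpD; apply: padic_norm_eventually_le.
exists j => n jn; rewrite padic_cauchyDE padic_cauchyNE padic_cauchy_natE.
exact: sE.
Qed.

(** The sets [S N] are not assumed closed, so [a] is only approximated by points of each [S N]. In
    the proof, [clust j b] says that the ball of radius [p ^- j] around [b] meets every [S N]. *)
Lemma padic_integers_compact (n : nat) (S : nat -> 'rV[Qp p_pr]_n -> Prop) :
  (forall M N xi, (M <= N)%N -> S N xi -> S M xi) ->
  (forall N, exists2 xi, S N xi & forall i, normp (xi ord0 i) <= 1) ->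
  exists2 a : 'rV[Qp p_pr]_n, (forall i, normp (a ord0 i) <= 1) &
    forall N, exists2 xi, S N xi &
      forall i, normp (xi ord0 i - a ord0 i) <= p%:R ^- N.
Proof.
move=> Santi S0.
pose clust j (b : 'I_n -> nat) := forall N, exists2 xi, S N xi &
  forall i, normp (xi ord0 i - (b i)%:R) <= p%:R ^- j.
(* The implication stands under the existential so that choice yields a total digit function; when
   [clust j b] fails, any digits will do. *)
have step j b : exists r : {ffun 'I_n -> 'I_p},
    clust j b -> clust j.+1 (fun i => b i + p ^ j * r i)%N.
  have [hb|] := pselect (clust j b); last by exists [ffun=> Ordinal (prime_gt0 p_pr)].
  apply: contrapT => /forallNP/= hr.
  have /choice[N hN] : forall r : {ffun 'I_n -> 'I_p}, exists N, ~ exists2 xi, S N xi &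
      forall i, normp (xi ord0 i - (b i + p ^ j * r i)%:R) <= p%:R ^- j.+1.
    by move=> r; have /not_implyP[_ /existsNP] := hr r.
  (* There are finitely many digit vectors [r]. If each refined ball missed some [S (N r)], a point
     of the current ball in the set of largest index would lie in one of the refined balls and, by
     monotonicity, in the set which that ball misses. *)
  have [xi Sx xb] := hb (\max_r N r).
  have /choice[r rx] : forall i, exists a : 'I_p,
      normp (xi ord0 i - (b i + p ^ j * a)%:R) <= p%:R ^- j.+1.
    by move=> i; have [a] := padic_digit (xb i); exists a; rewrite natrD opprD addrA.
  apply: (hN (finfun r)); exists xi; last by move=> i; rewrite ffunE.
  exact: Santi (leq_bigmax _) Sx.
have [g hg] : exists g : nat -> ('I_n -> nat) -> {ffun 'I_n -> 'I_p}, forall j b,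
    clust j b -> clust j.+1 (fun i => b i + p ^ j * g j b i)%N.
  by exists (fun j => projT1 (choice (step j))) => j; case: (choice (step j)).
pose b := fix b j := if j is j'.+1 then
  (fun i => b j' i + p ^ j' * g j' (b j') i)%N else (fun=> 0%N).
have bE j i : b j i = (\sum_(0 <= k < j) p ^ k * g k (b k) i)%N.
  by elim: j => [|j IH]; rewrite ?big_nil ?big_nat_recr //= IH.
have cb j : clust j (b j).
  elim: j => [N|j]; last exact: hg.
  by have [xi Sx x1] := S0 N; exists xi => // i; rewrite subr0 expr0 invr1.
have /choice[a ha] := fun i => padic_series (fun k => g k (b k) i).
exists (\row_i a i) => [i|N].
  by have := ha i 0%N; rewrite big_nil subr0 expr0 invr1 mxE.
(* The index [N] is used both for the set and for the precision: [xi] and [a] are each within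
   [p ^- N] of the partial sum [b N]. *)
have [xi Sx xb] := cb N N; exists xi => // i.
rewrite -(subrKA (b N i)%:R) mxE (le_trans (padic_normD _ _)) // ge_max xb /=.
by rewrite -padic_normN opprB bE ha.
Qed.
End PadicNorm.

(** * Polynomial estimates at integral points, and their transfer to large vectors by weighted
    dilation *)

Section Quasielliptic.
Variables (R : realType) (p : nat) (p_pr : prime p).
Implicit Types (x y : Qp p_pr).

Local Notation normp := (@padic_norm R p p_pr).

Let p_gt0 : 0 < p%:R :> R.
Proof. by rewrite ltr0n prime_gt0. Qed.

Let p_gt1 : 1 < p%:R :> R.
Proof. by rewrite ltr1n prime_gt1. Qed.

Lemma exprn_p_unbounded (e : R) : exists N, e < p%:R ^+ N.
Proof.
exists (Num.bound e); apply: lt_le_trans (upper_nthrootP (leqnn _)) _.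
by rewrite lerXn2r ?nnegrE ?ler0n // ler_nat prime_gt1.
Qed.

Lemma padic_norm_expV_eq0 x : (forall N, normp x <= p%:R ^- N) -> x = 0.
Proof.
move=> hx; apply/eqP/negPn; rewrite -(padic_norm_gt0 R) -leNgt leNgt; apply/negP => x0.
have [N hN] := exprn_p_unbounded (normp x)^-1.
have := hx N; apply/negP; rewrite -ltNge invf_plt ?posrE ?exprn_gt0 //.
Qed.

Lemma padic_norm_sum_le (I : Type) (s : seq I) (P : pred I) (F : I -> Qp p_pr)
    (B : R) : 0 <= B -> (forall i, P i -> normp (F i) <= B) ->
  normp (\sum_(i <- s | P i) F i) <= B.
Proof.
move=> B0 hF; elim/big_ind: _ => // [|x y hx hy]; first by rewrite padic_norm0.
by rewrite (le_trans (padic_normD _ _ _)) // ge_max hx.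
Qed.

Lemma padic_norm_prod (I : Type) (s : seq I) (F : I -> Qp p_pr) :
  normp (\prod_(i <- s) F i) = \prod_(i <- s) normp (F i).
Proof. by apply: (big_morph normp); [exact: padic_normM|exact: padic_norm1]. Qed.

Lemma padic_normD_eq x y : normp y < normp x -> normp (x + y) = normp x.
Proof.
move=> yx; apply/eqP; rewrite eq_le; apply/andP; split.
  by rewrite (le_trans (padic_normD _ _ _)) // ge_max lexx ltW.
have := padic_normD R (x + y) (- y).
by rewrite addrK padic_normN le_max [normp x <= normp y]leNgt yx orbF.
Qed.

(** The relation [close] contains the pairs of equal coefficients and is preserved by sums and
    products, hence by evaluation. Products rest on [x1 * x2 - y1 * y2 = x1 * (x2 - y2) + (x1 - y1)
    * y2], which is why [close] also records that both entries are integral. *)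
Lemma peval_lipschitz (n : nat) (f : mpoly n (Qp p_pr)) (e : R)
    (xi eta : 'rV[Qp p_pr]_n) :
  (forall m, normp (mcoeff m f) <= 1) ->
  (forall i, normp (xi ord0 i) <= 1) -> (forall i, normp (eta ord0 i) <= 1) ->
  0 <= e -> (forall i, normp (xi ord0 i - eta ord0 i) <= e) ->
  normp (peval f xi - peval f eta) <= e.
Proof.
move=> f1 xi1 eta1 e0 he.
pose close x y := [/\ normp x <= 1, normp y <= 1 & normp (x - y) <= e].
have closeM x1 y1 x2 y2 : close x1 y1 -> close x2 y2 -> close (x1 * x2) (y1 * y2).
  move=> [hx1 hy1 h1] [hx2 hy2 h2]; split; rewrite ?padic_normM ?mulr_ile1 ?padic_norm_ge0 //.
  rewrite -(subrKA (x1 * y2)) -mulrBr -mulrBl.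
  rewrite (le_trans (padic_normD _ _ _)) // ge_max !padic_normM.
  by rewrite -{1}[e]mul1r -[X in _ && (_ <= X)]mulr1 !ler_pM ?padic_norm_ge0.
have close1 : close 1 1 by split; rewrite ?padic_norm1 ?subrr ?padic_norm0.
suff [] : close (peval f xi) (peval f eta) by [].
rewrite /peval !mevalE; apply: (big_ind2 close).
- by split; rewrite ?subrr padic_norm0.
- move=> x1 y1 x2 y2 [hx1 hy1 h1] [hx2 hy2 h2].
  by split; [..|rewrite opprD addrACA];
    rewrite (le_trans (padic_normD _ _ _)) // ge_max ?hx1 ?hy1 ?h1.
move=> m _; apply/closeM.
  by split; [exact: f1|exact: f1|rewrite subrr padic_norm0].
apply: (big_ind2 close) => // i _; elim: (m i) => [|k IH]; first by rewrite !expr0.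
by rewrite !exprS; apply/closeM.
Qed.

(** Otherwise points with arbitrarily small values of [f] would accumulate at some [a]. The
    Lipschitz bound gives [f(a) = 0], so [a = 0], although each of these points keeps a coordinate
    away from 0. *)
Lemma anisotropic_lower_bound (n : nat) (f : mpoly n (Qp p_pr)) (w : 'I_n -> nat) :
  (forall m, normp (mcoeff m f) <= 1) ->
  (forall xi, peval f xi = 0 -> xi = 0) ->
  exists N, forall eta : 'rV[Qp p_pr]_n, (forall i, normp (eta ord0 i) <= 1) ->
    (exists i, p%:R ^- w i < normp (eta ord0 i)) ->
    p%:R ^- N <= normp (peval f eta).
Proof.
move=> f1 f0; apply: contrapT => /forallNP hN.
pose S N (eta : 'rV[Qp p_pr]_n) := [/\ forall i, normp (eta ord0 i) <= 1,
  exists i, p%:R ^- w i < normp (eta ord0 i) & normp (peval f eta) <= p%:R ^- N].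
have [||a a1 ha] := @padic_integers_compact R p p_pr n S.
- move=> M N eta MN [e1 e2 e3]; split => //; apply: le_trans e3 _.
  by rewrite lef_pV2 ?posrE ?exprn_gt0 // ler_eXn2l.
- move=> N; have /existsNP[eta /not_implyP[e1 /not_implyP[e2 /negP e3]]] := hN N.
  by exists eta => //; split => //; rewrite ltW // ltNge.
have /f0 a0 : peval f a = 0.
  apply: padic_norm_expV_eq0 => N; have [eta [e1 _ e3] ea] := ha N.
  rewrite -[peval f a](subrK (peval f eta)) (le_trans (padic_normD _ _ _)) // ge_max e3.
  rewrite andbT peval_lipschitz // ?invr_ge0 ?exprn_ge0 ?ler0n // => i.
  by rewrite -padic_normN opprB.
(* At precision [\max_i w i], every coordinate of [eta] is within [p ^- w i] of that of [a = 0],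
   against the choice of [i]. *)
have [eta [_ [i wi] _] /(_ i)] := ha (\max_i w i).
rewrite a0 mxE subr0 leNgt => /negP; apply; apply: le_lt_trans wi.
by rewrite lef_pV2 ?posrE ?exprn_gt0 // ler_eXn2l // leq_bigmax.
Qed.

(** Take [m] least such that every coordinate satisfies the upper bound. The strict inequality is
    the failure of that bound at [m - 1], multiplied by [p ^ w i]. *)
Lemma quasinorm_scale (n : nat) (w : 'I_n -> nat) (m0 : nat) (xi : 'rV[Qp p_pr]_n) :
  (forall i, 0 < w i)%N -> (0 < m0)%N ->
  p%:R ^+ (m0 * (\max_i w i)) <= padic_maxnorm R xi ->
  exists m, [/\ (m0 <= m)%N, forall i, normp (xi ord0 i) <= p%:R ^+ (m * w i) &
    exists i, p%:R ^+ (m * w i) < p%:R ^+ w i * normp (xi ord0 i)].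
Proof.
move=> w0 m00 hxi; pose P m := [forall i, normp (xi ord0 i) <= p%:R ^+ (m * w i)].
have exP : exists m, P m.
  have [N hN] := exprn_p_unbounded (padic_maxnorm R xi).
  exists N; apply/forallP => i; apply: le_trans (ltW (lt_le_trans hN _)) => //.
    by rewrite /padic_maxnorm (le_bigmax_cond _ (fun i => normp (xi ord0 i))).
  by rewrite ler_eXn2l // leq_pmulr.
case: (ex_minnP exP) => m /forallP Pm mmin.
have m0m : (m0 <= m)%N.
  (* As weights are positive, a zero maximum leaves no coordinates. The norm is then the empty
     maximum 0, which contradicts the hypothesis. *)
  have [W0|W0] := leqP (\max_i w i) 0.
    have : padic_maxnorm R xi <= 0.
      apply/bigmax_leP; split => // i _; have := leq_bigmax (F := w) i.
      by move/leq_trans/(_ W0); rewrite leqNgt w0.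
    by move/(le_trans hxi); rewrite leNgt exprn_gt0.
  have : p%:R ^+ (m0 * (\max_i w i)) <= p%:R ^+ (m * (\max_i w i)) :> R.
    apply: le_trans hxi _; apply/bigmax_leP; split => [|i _].
      by rewrite exprn_ge0 // ltW.
    by rewrite (le_trans (Pm i)) // ler_eXn2l // leq_mul2l leq_bigmax orbT.
  by rewrite ler_eXn2l // leq_pmul2r.
exists m; split => //.
have mgt0 := leq_trans m00 m0m.
(* Positivity of [m0] makes [m.-1] a genuine predecessor. *)
have : ~~ P m.-1.
  by apply/negP => /mmin; rewrite leqNgt prednK ?leqnn.
rewrite negb_forall => /existsP[i]; rewrite -ltNge => hi; exists i.
by rewrite -(ltr_pM2l (exprn_gt0 (w i) p_gt0)) -exprD -mulSn prednK in hi.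
Qed.

(** The exponent [d / w i] turns [p ^ (k * w i)] into [p ^ (k * d)] whatever [i] is. One large
    coordinate gives the lower bound; the upper bound adds [n] terms. *)
Lemma Xi_scale (n d m : nat) (w : 'I_n -> nat) (xi : 'rV[Qp p_pr]_n) :
  (forall i, 0 < w i)%N ->
  (forall i, normp (xi ord0 i) <= p%:R ^+ (m * w i)) ->
  (exists i, p%:R ^+ (m * w i) < p%:R ^+ w i * normp (xi ord0 i)) ->
  p%:R ^+ (m * d) <= p%:R ^+ d * Xi R d w xi /\ Xi R d w xi <= p%:R ^+ (m * d) *+ n.
Proof.
move=> w0 xi_le [i xi_i].
have powE j k : (p%:R ^+ (k * w j)) `^ (d%:R / (w j)%:R) = p%:R ^+ (k * d) :> R.
  rewrite -!powR_mulrn ?ltW // -powRrM; congr (_ `^ _).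
  by rewrite !natrM -mulrA; congr (_ * _); rewrite mulrCA divff ?mulr1 // pnatr_eq0 -lt0n.
have e0 j : 0 <= d%:R / (w j)%:R :> R by rewrite divr_ge0 ?ler0n.
split.
  rewrite -(powE i m).
  apply: (@le_trans _ _
    ((p%:R ^+ w i * normp (xi ord0 i)) `^ (d%:R / (w i)%:R))).
    by rewrite ge0_ler_powR // ?nnegrE ?mulr_ge0 ?exprn_ge0 ?padic_norm_ge0 // ltW.
  rewrite powRM ?exprn_ge0 ?padic_norm_ge0 ?(ltW p_gt0) //.
  have := powE i 1%N; rewrite !mul1n => ->; rewrite ler_pM2l ?exprn_gt0 //.
  by rewrite /Xi (bigD1 i) //= lerDl sumr_ge0 // => j _; rewrite powR_ge0.
rewrite -[X in _ *+ X]card_ord -sumr_const; apply: ler_sum => j _.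
by rewrite -(powE j m) ge0_ler_powR // ?nnegrE ?exprn_ge0 ?padic_norm_ge0 // ltW.
Qed.

(** A monomial of weighted degree [wdeg w k] is at most [p ^ (m * wdeg w k)]. The factor [p ^ m] on
    the left is the gain over degree [d], written so as to avoid the truncated subtraction
    [d - 1]. *)
Lemma peval_lower_order_le (n d m : nat) (w : 'I_n -> nat)
    (a : multinom n -> Qp p_pr) (C : R) (xi : 'rV[Qp p_pr]_n) : 0 <= C ->
  (forall k : bmultinom n d, (wdeg w k < d)%N -> normp (a k) <= C) ->
  (forall i, normp (xi ord0 i) <= p%:R ^+ (m * w i)) ->
  normp (peval (\sum_(k : bmultinom n d | (wdeg w k < d)%N) a k *: mpolyX _ k) xi)
    * p%:R ^+ m <= C * p%:R ^+ (m * d).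
Proof.
move=> C0 aC xi_le; have pm : 0 < p%:R ^+ m :> R by rewrite exprn_gt0.
rewrite -ler_pdivlMr // /peval raddf_sum /=; apply: padic_norm_sum_le.
  by rewrite divr_ge0 ?mulr_ge0 ?exprn_ge0 // ltW.
move=> k kd; rewrite mevalZ mevalX padic_normM padic_norm_prod ler_pdivlMr // -mulrA.
apply: ler_pM; rewrite ?padic_norm_ge0 ?aC //.
  by rewrite mulr_ge0 ?prodr_ge0 ?(ltW pm) // => i _; rewrite padic_norm_ge0.
apply: (@le_trans _ _ (p%:R ^+ (m * (wdeg w k).+1))); last first.
  by rewrite ler_eXn2l // leq_mul2l kd orbT.
rewrite mulnS addnC exprD ler_pM2r // /wdeg big_distrr /= -prodrXr.
apply: ler_prod => i _; rewrite padic_norm_ge0 padic_normX /=.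
by rewrite mulnCA mulnC exprM lerXn2r // nnegrE ?padic_norm_ge0 // exprn_ge0 // ltW.
Qed.

(** Dilation by [p ^+ m], whose norm is [p ^- m], sends [xi] to an integral point with a coordinate
    bounded below, and divides the norm of [f] by [p ^ (m * d)]. *)
Lemma quasielliptic_scale (n d : nat) (f : mpoly n (Qp p_pr)) (w : 'I_n -> nat) :
  quasielliptic R f d w ->
  exists N, forall m (xi : 'rV[Qp p_pr]_n),
    (forall i, normp (xi ord0 i) <= p%:R ^+ (m * w i)) ->
    (exists i, p%:R ^+ (m * w i) < p%:R ^+ w i * normp (xi ord0 i)) ->
    p%:R ^- N * p%:R ^+ (m * d) <= normp (peval f xi) <= p%:R ^+ (m * d).
Proof.
case=> w0 _ f1 fh f0.
have [N hN] := anisotropic_lower_bound w f1 (fun xi => (f0 xi).1).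
exists N => m xi xi_le [i xi_i].
have np k : normp (p%:R ^+ k) = p%:R ^- k.
  by rewrite padic_normX padic_norm_p exprVn.
have etaE j : normp (wdilate w (p%:R ^+ m) xi ord0 j) =
    normp (xi ord0 j) / p%:R ^+ (m * w j).
  by rewrite mxE padic_normM -exprM np mulrC.
have eta1 j : normp (wdilate w (p%:R ^+ m) xi ord0 j) <= 1.
  by rewrite etaE ler_pdivrMr ?exprn_gt0 // mul1r.
have fE : normp (peval f (wdilate w (p%:R ^+ m) xi)) =
    normp (peval f xi) / p%:R ^+ (m * d).
  rewrite fh; first by rewrite padic_normM -exprM np mulrC.
  by rewrite -(padic_norm_gt0 R) np invr_gt0 exprn_gt0.
apply/andP; split.
  rewrite -ler_pdivlMr ?exprn_gt0 // -fE; apply: hN => //.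
  exists i; rewrite etaE ltr_pdivlMr ?exprn_gt0 // mulrC.
  by rewrite ltr_pdivrMr ?exprn_gt0 // mulrC.
(* The upper bound is the Lipschitz estimate between the dilated point and 0, with constant 1. *)
rewrite -[leRHS]mul1r -ler_pdivrMr ?exprn_gt0 // -fE -[peval _ _]subr0.
have <- : peval f 0 = 0 by apply/f0.
have z j : (0 : 'rV[Qp p_pr]_n) ord0 j = 0 by rewrite mxE.
by apply: peval_lipschitz => // j; rewrite z ?subr0 ?padic_norm0.
Qed.

(** Only finitely many multi-indices occur, so the sum of the absolute values of their individual
    bounds serves for all of them. *)
Lemma semi_quasielliptic_coef_bounded (n d : nat) (f : mpoly n (Qp p_pr))
    (w : 'I_n -> nat) (c : multinom n -> 'rV[Qp p_pr]_n -> Qp p_pr) :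
  semi_quasielliptic R f d w c -> exists2 C : R, 0 <= C &
    forall (k : bmultinom n d) xi, (wdeg w k < d)%N -> normp (c k xi) <= C.
Proof.
move=> [_ cb].
have /choice[C hC] : forall k : bmultinom n d, exists C : R,
    forall xi, (wdeg w k < d)%N -> normp (c k xi) <= C.
  move=> k; have [kd|] := boolP (wdeg w k < d)%N; last by exists 0.
  have := cb k kd; set s := ereal_sup _ => s_lt.
  have ub xi : ((normp (c k xi))%:E <= s)%E by apply: ereal_sup_ubound; exists xi.
  exists (fine s) => xi _; rewrite -lee_fin fineK ?ub //.
  by rewrite fin_numElt s_lt andbT (lt_le_trans _ (ub 0)) // ltNyr.
exists (\sum_k `|C k|) => [|k xi kd]; first by rewrite sumr_ge0.
rewrite (le_trans (hC k xi kd)) // (le_trans (ler_norm _)) //.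
by rewrite (bigD1 k) //= lerDl sumr_ge0.
Qed.

End Quasielliptic.

Theorem theorem4p2 (R : realType) (p : nat) (p_pr : prime p) (n : nat)
    (d : nat) (w : 'I_n -> nat) (f : mpoly n (Qp p_pr))
    (c : multinom n -> 'rV[Qp p_pr]_n -> Qp p_pr)
    (F_sqe : semi_quasielliptic R f d w c) :
  exists (A0 A1 : R) (M0 : nat),
    [/\ 0 < A0, 0 < A1, (0 < M0)%N &
      forall x xi : 'rV[Qp p_pr]_n,
        p%:R ^+ M0 <= padic_maxnorm R xi ->
        A0 * Xi R d w xi
          <= padic_norm R (peval (semi_quasielliptic_poly f d w c x) xi)
          <= A1 * Xi R d w xi].
Proof.
have p_gt1 : 1 < p%:R :> R by rewrite ltr1n prime_gt1.
have p_gt0 : 0 < p%:R :> R by rewrite (lt_trans ltr01).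
have fq := sqe_quasielliptic F_sqe; have w0 := qe_weights fq.
have [N hN] := quasielliptic_scale fq.
have [C C0 hC] := semi_quasielliptic_coef_bounded F_sqe.
(* From scale [m0] on, the gain [p ^ m] beats both the coefficient bound [C] and the loss [p ^ N] in
   the lower bound for [f]. *)
have [m0 hm0] := exprn_p_unbounded p_pr (C * p%:R ^+ N).
(* [n.+1] is a visibly positive number above the [n] terms of [Xi]. In [M0], the inner successor
   makes the scale positive and the outer one makes [M0] positive. *)
exists (p%:R ^- N / n.+1%:R), (p%:R ^+ d), (m0.+1 * \max_i w i).+1.
split; rewrite ?divr_gt0 ?invr_gt0 ?exprn_gt0 ?ltr0Sn // => x xi xi_ge.
have [|m [m0m xi_le xi_lt]] := @quasinorm_scale R p p_pr n w m0.+1 xi w0 isT.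
  by apply: le_trans xi_ge; rewrite ler_eXn2l.
have [Xi_ge Xi_le] := Xi_scale d w0 xi_le xi_lt.
have /andP[f_ge f_le] := hN _ _ xi_le xi_lt.
have pX k : 0 < p%:R ^+ k :> R by rewrite exprn_gt0.
have -> : padic_norm R (peval (semi_quasielliptic_poly f d w c x) xi) =
    padic_norm R (peval f xi).
  rewrite /semi_quasielliptic_poly /peval mevalD padic_normD_eq //.
  apply: lt_le_trans f_ge; rewrite -(ltr_pM2r (pX m)).
  have low := peval_lower_order_le (a := fun k => c k x) C0 (fun k => hC k x) xi_le.
  apply: le_lt_trans low _.
  (* After cancelling [p ^ (m * d)], the claim is [C * p ^ N < p ^ m]. *)
  rewrite mulrAC ltr_pM2r // mulrC ltr_pdivlMr //.
  by apply: lt_le_trans hm0 _; rewrite ler_eXn2l // ltnW.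
rewrite (le_trans f_le) // andbT; apply: le_trans f_ge.
rewrite -mulrA ler_pM2l ?invr_gt0 // mulrC ler_pdivrMr ?ltr0n //.
by rewrite (le_trans Xi_le) // mulr_natr mulrSr lerDl ltW.
Qed.
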